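(* Let $n\geq 1$ be an integer and let $\mathfrak{D}_{2n}$ be any algorithm that, given any clutter $\mathcal{C}$ over a ground set of $2n$ elements via a filter oracle, decides whether or not $\mathcal{C}$ has a $\Delta_3$ minor. Then in the worst case, $\mathfrak{D}_{2n}$ must make at least $2^n$ calls to the filter oracle.
   Context: A clutter over a finite ground set $V$ is a family $\mathcal{C}$ of subsets of $V$ (called members) such that no member contains another. A filter oracle for a clutter $\mathcal{C}$ consists of the ground set $V$ together with an oracle which, given any set $X\subseteq V$, decides in unit time whether or not $X$ contains a member of $\mathcal{C}$. For disjoint $I,J\subseteq V$, the minor $\mathcal{C}\setminus I/J$ is the clutter over ground set $V-(I\cup J)$ whose members are the inclusionwise minimal sets in $\{C-J: C\in\mathcal{C},\ C\cap I=\emptyset\}$; a minor of $\mathcal{C}$ is any clutter of this form. Two clutters are isomorphic if one is obtained from the other by relabeling the ground set. $\Delta_3$ denotes any clutter isomorphic to $\{\{1,2\},\{2,3\},\{3,1\}\}$ (over ground set $\{1,2,3\}$).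
   Formalization: The formal theorem assumes n ≥ 2 instead of n ≥ 1: for n = 1 the claim is false, since a clutter over 2 elements never has a Δ₃ minor and the algorithm that answers ''no'' makes 0 calls. *)

(* Defs.v *)
From mathcomp Require Import all_boot.
Set Implicit Arguments.
Unset Strict Implicit.
Unset Printing Implicit Defensive.

Definition antichain (T : finType) (F : {set {set T}}) : bool :=
  [forall A in F, forall B in F, (A \subset B) ==> (A == B)].

(* A clutter over the ground set V; V is a subset of an ambient finite type so
   that the minors of a clutter, whose ground sets are smaller, live over the
   same type. *)
Record clutter (T : finType) (V : {set T}) := Clutter {
  members :> {set {set T}};
  members_sub : [forall A in members, A \subset V];
  members_antichain : antichain members }.

Section Minor.
Variables (T : finType) (V : {set T}).

Definition minor_family (C : clutter V) (I J : {set T}) : {set {set T}} :=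
  [set A :\: J | A in C & [disjoint A & I]].

Definition minor_members (C : clutter V) (I J : {set T}) : {set {set T}} :=
  [set B | minset [in minor_family C I J] B].

Lemma minor_members_sub (C : clutter V) (I J : {set T}) :
  [forall A in minor_members C I J, A \subset V :\: (I :|: J)].
Proof.
apply/forall_inP => B; rewrite inE => /minsetp /imsetP[A].
rewrite inE => /andP[AC AI] ->; apply/subsetP => x; rewrite !inE.
case/andP => xJ xA; rewrite negb_or xJ andbT (disjointFr AI xA).
exact: (subsetP (forall_inP (members_sub C) A AC)).
Qed.

Lemma minor_members_antichain (C : clutter V) (I J : {set T}) :
  antichain (minor_members C I J).
Proof.
apply/forall_inP => A; rewrite inE => /minsetp FA.
apply/forall_inP => B; rewrite inE => /minsetP[_ minB].
by apply/implyP => /(minB _ FA) ->.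
Qed.

(* The minor C \ I / J. *)
Definition minor (C : clutter V) (I J : {set T}) :
    clutter (V :\: (I :|: J)) :=
  Clutter (minor_members_sub C I J) (minor_members_antichain C I J).

End Minor.

Definition clutter_iso (T T' : finType) (V : {set T}) (V' : {set T'})
    (C : clutter V) (C' : clutter V') : Prop :=
  exists f : T -> T',
    [/\ {in V &, injective f}, f @: V = V'
      & [set f @: A | A : {set T} in C] = C' :> {set {set T'}}].

Definition has_minor (T T' : finType) (V : {set T}) (V' : {set T'})
    (C : clutter V) (M : clutter V') : Prop :=
  exists I J : {set T},
    [/\ I \subset V, J \subset V, [disjoint I & J] & clutter_iso (minor C I J) M].

Definition Delta3_members : {set {set 'I_3}} :=
  let v i : 'I_3 := inord i in
  [set [set v 0; v 1]; [set v 1; v 2]; [set v 2; v 0]].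

Lemma Delta3_members_card (A : {set 'I_3}) : A \in Delta3_members -> #|A| = 2.
Proof.
by rewrite !inE => /orP[/orP[]|] /eqP->; rewrite cards2 -val_eqE /= !inordK.
Qed.

Lemma Delta3_members_sub : [forall A in Delta3_members, A \subset [set: 'I_3]].
Proof. by apply/forall_inP => A _; apply: subsetT. Qed.

Lemma Delta3_members_antichain : antichain Delta3_members.
Proof.
apply/forall_inP => A /Delta3_members_card cA.
apply/forall_inP => B /Delta3_members_card cB; apply/implyP => AB.
by rewrite eqEcard AB cA cB.
Qed.

Definition Delta3 : clutter [set: 'I_3] :=
  Clutter Delta3_members_sub Delta3_members_antichain.

Definition filter_oracle (T : finType) (V : {set T}) (C : clutter V)
    (X : {set T}) : bool :=
  [exists A in C, A \subset X].

(* Deterministic adaptive oracle algorithms over the ground set V: everything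
   the algorithm does between two oracle calls is free, and its next move
   depends only on the answers received so far. *)
Inductive algorithm (V : finType) : Type :=
| Answer of bool
| Query of {set V} & (bool -> algorithm V).

Arguments Answer {V}.

Fixpoint output (V : finType) (D : algorithm V) (o : {set V} -> bool) : bool :=
  match D with
  | Answer b => b
  | Query X k => output (k (o X)) o
  end.

(* Repeated queries are counted each time. *)
Fixpoint calls (V : finType) (D : algorithm V) (o : {set V} -> bool) : nat :=
  match D with
  | Answer _ => 0
  | Query X k => (calls (k (o X)) o).+1
  end.

Definition decides_Delta3_minor (V : finType) (D : algorithm V) : Prop :=
  forall C : clutter [set: V],
    output D (filter_oracle C) = true <-> has_minor C Delta3.

(* On a ground set with fewer than 3 elements no oracle call is needed, so the
   lower bound 2 ^ n on a ground set of 2n elements can only hold for n >= 2. *)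
Lemma decides_Delta3_minor_small (V : finType) :
  #|V| < 3 -> decides_Delta3_minor (Answer false : algorithm V).
Proof.
move=> V3 C; split=> // -[I [J [_ _ _ [f [_ fV _]]]]].
have := leq_trans (leq_imset_card f _) (max_card [in [set: V] :\: (I :|: J)]).
by rewrite fV cardsT card_ord leqNgt V3.
Qed.

(* Main.v *)
Require Import Defs.
From mathcomp Require Import all_boot.
Set Implicit Arguments.
Unset Strict Implicit.
Unset Printing Implicit Defensive.

(** In terms of the monotone function [g] computed by the filter oracle, a
    [Delta3] minor is a restriction of [g] to three variables that is the
    majority function.

    Split the ground set into [n] pairs, one of which, [{x, y}], is
    distinguished.  Let [g] be true on sets containing [x] and [y], and false on
    sets containing neither.  On a set [X] containing exactly one of them, [g]
    looks at the other pairs: if [X] meets each of them in one element, [g X] is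
    the parity of [X]; if [X] contains some pair and misses none, [g X] is true;
    if [X] misses some pair and contains none, it is false; if both happen, it
    is false for [x] and true for [y].  Whatever values replace the parity on
    the [2 ^ n] transversals of the pairs, [g] stays monotone.  With the parity
    there is no majority restriction, but changing it at any single transversal
    creates one, because this transversal then agrees with the one in which [x]
    and [y] are swapped.  An algorithm must therefore query every transversal. *)

(** * Majority restrictions of set predicates *)

Definition monotone_pred (V : finType) (g : {set V} -> bool) :=
  forall X Y : {set V}, X \subset Y -> g X -> g Y.

(** Only the two middle levels of the majority function are prescribed: for a monotone [g] the
    values with none or all of the points follow. Distinctness of the points and their absence from
    [J] also follow, as [majority_inj] and [majority_notin] show. *)
Definition majority_restriction (V : finType) (g : {set V} -> bool) :=
  exists (v : 'I_3 -> V) (J : {set V}),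
    (forall i, ~~ g (v i |: J)) /\
    (forall i j, i != j -> g (v i |: (v j |: J))).

Section Majority.
Variables (V : finType) (g : {set V} -> bool) (v : 'I_3 -> V) (J : {set V}).
Hypotheses (g1 : forall i, ~~ g (v i |: J))
  (g2 : forall i j, i != j -> g (v i |: (v j |: J))).

Lemma majority_inj : injective v.
Proof.
move=> i j eq_v; apply/eqP; apply: contraT => /g2.
by rewrite eq_v setUA setUid (negbTE (g1 j)).
Qed.

Lemma majority_notin i : v i \notin J.
Proof.
apply/negP => viJ; have [j nij] : exists j, i != j.
  exists (if i == ord0 then ord_max else ord0); by case: (eqVneq i ord0) => [->|].
have := g2 nij; have -> : v i |: (v j |: J) = v j |: J.
  by apply/setUidPr; rewrite sub1set setU1r.
exact/negP.
Qed.

End Majority.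

Lemma ord3_third (i j : 'I_3) : exists k, (k != i) && (k != j).
Proof.
have /set0Pn[k] : ~: [set i; j] != set0.
  rewrite -card_gt0 cardsCs setCK card_ord cards2.
  by case: (i != j).
by rewrite !inE negb_or => ?; exists k.
Qed.

(** * [Delta3] minors as majority restrictions of the filter oracle *)

Lemma filter_oracleP (T : finType) (V : {set T}) (C : clutter V) (X : {set T}) :
  reflect (exists2 A, A \in members C & A \subset X) (filter_oracle C X).
Proof. exact: exists_inP. Qed.

Section FilterOracle.
Variables (T : finType) (V : {set T}) (C : clutter V).

Lemma members_subset A : A \in members C -> A \subset V.
Proof. exact: (forall_inP (members_sub C)). Qed.

Lemma members_eq A B :
  A \in members C -> B \in members C -> A \subset B -> A = B.
Proof.
move=> Am BC AB; apply/eqP.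
exact: (implyP (forall_inP (forall_inP (members_antichain C) A Am) B BC)).
Qed.

(** Passing to minimal sets does not change which sets contain some [A :\: J], and disjointness from
    [I] makes every member inside [X :|: J] survive the deletion. *)
Lemma filter_oracle_minor (I J X : {set T}) :
  [disjoint X :|: J & I] ->
  filter_oracle (minor C I J) X = filter_oracle C (X :|: J).
Proof.
move=> dis; apply/filter_oracleP/filter_oracleP => [[B]|[A Am AXJ]].
  rewrite inE => /minsetp /imsetP[A]; rewrite inE => /andP[Am _] -> sAX.
  by exists A => //; rewrite setUC -subDset.
have FA : A :\: J \in minor_family C I J.
  by apply: imset_f; rewrite inE; apply/andP; split=> //; apply: disjointWl AXJ dis.
have [B minB sBA] := @minset_exists _ [in minor_family C I J] _ FA.
exists B; first by rewrite inE.
by apply: subset_trans sBA _; rewrite subDset setUC.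
Qed.

End FilterOracle.

Lemma mem_Delta3 (A : {set 'I_3}) : (A \in members Delta3) = (#|A| == 2).
Proof.
apply/idP/eqP => [/Delta3_members_card //|/eqP/cards2P[i [j [nij ->]]]].
have v_eq (k : 'I_3) : k = inord k by rewrite inord_val.
move: nij; rewrite (v_eq i) (v_eq j) !inE.
case: i => [[|[|[|//]]] ?] //=; case: j => [[|[|[|//]]] ?] //=; rewrite ?eqxx //.
- by rewrite [X in _ || (X == _)]setUC eqxx !orbT.
- by rewrite [X in (X == _) || _ || _]setUC eqxx.
- by rewrite orbT.
- by rewrite orbT.
- by rewrite [X in _ || (X == _) || _]setUC eqxx orbT.
Qed.

(** The points are the preimages of the three vertices, and the contracted set serves as [J]. *)
Lemma majority_of_Delta3 (V : finType) (C : clutter [set: V]) :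
  has_minor C Delta3 -> majority_restriction (filter_oracle C).
Proof.
case=> I [J [_ _ disIJ [f [f_inj fV fC]]]].
set W := _ :\: _ in f_inj fV.
have /fin_all_exists2[v vW fv] i : exists2 x, x \in W & f x = i.
  have : i \in f @: W by rewrite fV inE.
  by case/imsetP=> x xW ->; exists x.
have dis (X : {set V}) : X \subset W -> [disjoint X :|: J & I].
  move=> XW; rewrite disjoints_subset subUset -!disjoints_subset.
  rewrite (disjoint_sym J) disIJ andbT; apply: disjointWl XW _.
  rewrite disjoints_subset; apply/subsetP => x.
  by rewrite !inE negb_or => /andP[/andP[]].
exists v, J; split=> [i|i j nij].
  rewrite -(@filter_oracle_minor _ _ C I) ?dis ?sub1set //.
  apply/filter_oracleP => -[A Am Ai].
  have : f @: A \in members Delta3 by rewrite -fC imset_f.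
  rewrite mem_Delta3 => /eqP cA; have := leq_imset_card f A.
  by rewrite cA leqNgt ltnS (leq_trans (subset_leq_card Ai)) ?cards1.
rewrite setUA -(@filter_oracle_minor _ _ C I) ?dis ?subUset ?sub1set ?vW //.
apply/filter_oracleP.
have : [set i; j] \in members Delta3 by rewrite mem_Delta3 cards2 nij.
rewrite -fC => /imsetP[A Am eq_ij]; exists A => //.
apply/subsetP => x xA.
have xW : x \in W by apply: (subsetP (members_subset Am)).
have : f x \in [set i; j] by rewrite eq_ij imset_f.
by rewrite !inE -{1}(fv i) -{1}(fv j) !(inj_in_eq f_inj).
Qed.

(** Contract [J] and delete everything except [J] and the three points. *)
Lemma Delta3_of_majority (V : finType) (C : clutter [set: V]) :
  majority_restriction (filter_oracle C) -> has_minor C Delta3.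
Proof.
case=> v [J [g1 g2]].
have v_inj := majority_inj g1 g2; have vJ := majority_notin g1 g2.
set W := v @: [set: 'I_3].
have disJW : [disjoint J & W].
  rewrite disjoint_sym disjoints_subset; apply/subsetP => _ /imsetP[i _ ->].
  by rewrite inE.
set I := ~: (J :|: W).
have WE : [set: V] :\: (I :|: J) = W.
  apply/setP => x; rewrite !inE andbT negb_or negbK; apply/andP/idP => [[/orP[->|//]]|xW] //.
  by rewrite xW orbT (disjointFl disJW).
exists I, J; split; rewrite ?subsetT //.
  by rewrite disjoints_subset; apply/subsetP => x; rewrite !inE; case: (x \in J).
(* The relabelling inverts [v]; [ord0] is a dummy value outside [W]. *)
pose f x := odflt ord0 [pick i | v i == x].
have fK : cancel v f.
  move=> i; rewrite /f; case: pickP => [j /eqP/v_inj //|/(_ i)].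
  by rewrite eqxx.
have vf : {in W, cancel f v} by move=> _ /imsetP[i _ ->]; rewrite fK.
have orc (B : {set 'I_3}) :
    filter_oracle (minor C I J) (v @: B) = filter_oracle C (v @: B :|: J).
  apply: filter_oracle_minor; rewrite disjoints_subset setCK setUC setUS //.
  exact/imsetS/subsetT.
have g12 (B : {set 'I_3}) :
    filter_oracle (minor C I J) (v @: B) = (1 < #|B|).
  rewrite orc; apply/idP/idP => [|/card_gt1P[i [j [iB jB nij]]]].
    apply: contraLR; rewrite -leqNgt => /card_le1_eqP B1.
    have [i Bi] : exists i, B \subset [set i].
      have [->|/set0Pn[i iB]] := eqVneq B set0; first by exists ord0; apply: sub0set.
      by exists i; apply/subsetP => j jB; rewrite inE; apply/eqP/B1.
    apply: contra (g1 i) => /filter_oracleP[A Am sA]; apply/filter_oracleP.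
    exists A => //; apply: subset_trans sA _.
    by rewrite setSU // -(imset_set1 v) imsetS.
  have /filter_oracleP[A Am sA] := g2 _ _ nij; apply/filter_oracleP.
  exists A => //; apply: subset_trans sA _.
  by rewrite setUA setSU // subUset !sub1set !imset_f.
have vfA (A : {set V}) : A \subset W -> v @: (f @: A) = A.
  move=> /subsetP AW; apply/setP => x; apply/imsetP/idP => [[_ /imsetP[y yA ->] ->]|xA].
    by rewrite vf ?AW.
  by exists (f x); rewrite ?imset_f // vf ?AW.
have minW A : A \in members (minor C I J) -> A \subset W.
  by move/members_subset; rewrite WE.
exists f; split.
- by move=> x y; rewrite WE => /vf {2}<- /vf {2}<- ->.
- rewrite WE; apply/setP => i; rewrite inE; apply/imsetP; exists (v i) => //.
  exact: imset_f.
apply/setP => B; rewrite mem_Delta3; apply/imsetP/idP => [[A Am ->]|/eqP cB].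
  have := g12 (f @: A); rewrite vfA ?minW // => gA.
  have A2 : 1 < #|f @: A|.
    by rewrite -gA; apply/filter_oracleP; exists A.
  have /card_gt1P[i [j [iA jA nij]]] := A2.
  have : filter_oracle (minor C I J) (v @: [set i; j]) by rewrite g12 cards2 nij.
  case/filter_oracleP=> A' A'm sA'.
  (* Two points of [A] already contain a member of the minor, which is [A] itself by the antichain
     property; so [A] has no third point. *)
  have eqA : A' = A.
    apply: (members_eq A'm Am); apply: subset_trans sA' _.
    rewrite -(vfA A (minW _ Am)); apply: imsetS.
    by rewrite subUset !sub1set iA.
  rewrite eqn_leq A2 andbT -eqA; apply: leq_trans (leq_imset_card _ _) _.
  apply: leq_trans (subset_leq_card sA') _.
  by apply: leq_trans (leq_imset_card _ _) _; rewrite cards2 nij.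
have : filter_oracle (minor C I J) (v @: B) by rewrite g12 cB.
case/filter_oracleP=> A Am sA; exists A => //.
have fAB : f @: A \subset B.
  by apply/subsetP => _ /imsetP[x /(subsetP sA) /imsetP[i iB ->] ->]; rewrite fK.
apply/esym/eqP; rewrite eqEcard fAB cB -g12 vfA ?minW //.
by apply/filter_oracleP; exists A.
Qed.

(** * Clutters from monotone predicates, and the queries of a run *)

Section ClutterOfMonotone.
Variables (V : finType) (g : {set V} -> bool).

Definition minimal_sets := [set A | minset g A].

Lemma minimal_sets_sub : [forall A in minimal_sets, A \subset [set: V]].
Proof. by apply/forall_inP => A _; apply: subsetT. Qed.

Lemma minimal_sets_antichain : antichain minimal_sets.
Proof.
apply/forall_inP => A; rewrite inE => /minsetp gA.
apply/forall_inP => B; rewrite inE => /minsetP[_ minB].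
by apply/implyP => /(minB _ gA) ->.
Qed.

Definition clutter_of : clutter [set: V] :=
  Clutter minimal_sets_sub minimal_sets_antichain.

Lemma filter_oracle_clutter_of :
  monotone_pred g -> filter_oracle clutter_of =1 g.
Proof.
move=> g_mono X; apply/filter_oracleP/idP => [[A]|gX].
  by rewrite inE => /minsetp gA sAX; apply: g_mono gA.
by have [A minA sAX] := minset_exists gX; exists A; rewrite ?inE.
Qed.

End ClutterOfMonotone.

(** [qs] lists the queries of the run on [o]; an oracle that agrees on them follows the same
    branch. *)
Lemma output_determined (V : finType) (D : algorithm V) (o : {set V} -> bool) :
  exists2 qs : seq {set V}, size qs = calls D o
    & forall o', {in qs, o =1 o'} -> output D o' = output D o.
Proof.
elim: D => [b|X k IH] /=; first by exists [::].
have [qs <- qsP] := IH (o X); exists (X :: qs) => //= o' oo'.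
rewrite -oo' ?mem_head //; apply: qsP => Y Yqs.
by apply: oo'; rewrite inE Yqs orbT.
Qed.

Lemma majority_restrictionI (V : finType) (g : {set V} -> bool) a b c J :
  ~~ g (a |: J) -> ~~ g (b |: J) -> ~~ g (c |: J) ->
  g (a |: (b |: J)) -> g (a |: (c |: J)) -> g (b |: (c |: J)) ->
  majority_restriction g.
Proof.
move=> ga gb gc gab gac gbc; exists (fun i : 'I_3 => nth a [:: a; b; c] i), J.
split; first by case=> [[|[|[|//]]] ?].
by case=> [[|[|[|//]]] ?] [[|[|[|//]]] ?] //= _; rewrite // setUCA.
Qed.

(** At most one of the three distinct points lies outside [[set a; b]], so the others fill it. *)
Lemma majority_hits_pair (V : finType) (v : 'I_3 -> V) (a b : V) :
  injective v ->
  (forall i j, i != j -> (v i \in [set a; b]) || (v j \in [set a; b])) ->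
  exists i j, v i = a /\ v j = b.
Proof.
move=> v_inj v_ab; pose K := [set i | v i \notin [set a; b]].
have K1 : #|K| <= 1.
  apply/card_le1_eqP => i j; rewrite ![_ \in K]inE => iK jK.
  apply/eqP; apply: contraT => /v_ab.
  by rewrite (negbTE iK) (negbTE jK).
have /eqP vK : v @: (~: K) == [set a; b].
  rewrite eqEcard; apply/andP; split.
    by apply/subsetP => _ /imsetP[i + ->]; rewrite inE [_ \in K]inE negbK.
  rewrite cards2 card_imset // cardsCs setCK card_ord.
  by apply: leq_trans (leq_sub2l 3 K1); case: (a != b).
have /imsetP[i _ ->] : a \in v @: (~: K) by rewrite vK set21.
have /imsetP[j _ ->] : b \in v @: (~: K) by rewrite vK set22.
by exists i, j.
Qed.

(** * The switch predicate on a ground set split into pairs [el i true], [el i false] *)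

Section Pairs.
Variables (V I : finType) (el : I -> bool -> V) (idx : V -> I) (side : V -> bool).
Hypotheses (elK : forall u, el (idx u) (side u) = u)
  (idx_el : forall i b, idx (el i b) = i)
  (side_el : forall i b, side (el i b) = b).
Variable i0 : I.
Implicit Types (X Y J : {set V}) (p : {set V} -> bool).

Lemma el_eq i b j c : (el i b == el j c) = (i == j) && (b == c).
Proof.
apply/eqP/andP => [e|[/eqP-> /eqP->] //].
by have := (congr1 idx e, congr1 side e); rewrite !idx_el !side_el => -[-> ->].
Qed.

Lemma elP (Q : V -> Prop) : (forall i b, Q (el i b)) -> forall u, Q u.
Proof. by move=> Qel u; rewrite -(elK u). Qed.

Definition misses_pair X :=
  [exists i, [&& i != i0, el i true \notin X & el i false \notin X]].

Definition contains_pair X :=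
  [exists i, [&& i != i0, el i true \in X & el i false \in X]].

Lemma misses_pairP X :
  reflect (exists2 i, i != i0 & forall b, el i b \notin X) (misses_pair X).
Proof.
apply: (iffP existsP) => [[i /and3P[ni ti fi]]|[i ni iX]].
  by exists i => // -[].
by exists i; rewrite ni !iX.
Qed.

Lemma contains_pairP X :
  reflect (exists2 i, i != i0 & forall b, el i b \in X) (contains_pair X).
Proof.
apply: (iffP existsP) => [[i /and3P[ni ti fi]]|[i ni iX]].
  by exists i => // -[].
by exists i; rewrite ni !iX.
Qed.

Lemma misses_pairI i b X :
  i != i0 -> el i b \notin X -> el i (~~ b) \notin X -> misses_pair X.
Proof. by move=> ni ib inb; apply/misses_pairP; exists i => //; case: b ib inb => ? ? []. Qed.

Lemma contains_pairI i b X :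
  i != i0 -> el i b \in X -> el i (~~ b) \in X -> contains_pair X.
Proof. by move=> ni ib inb; apply/contains_pairP; exists i => //; case: b ib inb => ? ? []. Qed.

Lemma misses_pairS X Y : X \subset Y -> misses_pair Y -> misses_pair X.
Proof.
move=> sXY /misses_pairP[i ni iY]; apply/misses_pairP; exists i => // b.
by apply: contra (iY b); apply: (subsetP sXY).
Qed.

Lemma contains_pairS X Y : X \subset Y -> contains_pair X -> contains_pair Y.
Proof.
move=> sXY /contains_pairP[i ni iY]; apply/contains_pairP; exists i => // b.
exact: (subsetP sXY).
Qed.

(** Here [el i0 true] is x and [el i0 false] is y. For sets with exactly one of them, the two
    formulas differ only when one of the other pairs is missed and another contained. *)
Definition switch_pred p X :=
  if el i0 true \in X
  then (el i0 false \in X) || ~~ misses_pair X && (contains_pair X || p X)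
  else (el i0 false \in X) && (contains_pair X || ~~ misses_pair X && p X).

Lemma switch_pred_mono p : monotone_pred (switch_pred p).
Proof.
move=> X Y sXY; have sub u := subsetP sXY u.
(* When both values come from [p], the nested sets [X] and [Y] take exactly one element of each
   other pair, hence coincide. This is why [p] can be arbitrary. *)
have XY_eq : (el i0 true \in X) = (el i0 true \in Y) ->
    (el i0 false \in X) = (el i0 false \in Y) ->
    ~~ misses_pair X -> ~~ contains_pair Y -> X = Y.
  move=> eqt eqf mX cY; apply/eqP; rewrite eqEsubset sXY /=.
  apply/subsetP; apply: elP => i b.
  have [->|ni iY] := eqVneq i i0; first by case: b; rewrite ?eqt ?eqf.
  apply: contraT => iX; case/negP: cY; apply: (contains_pairI ni iY).
  by apply: sub; apply: contraR mX => /(misses_pairI ni iX).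
have mXY : ~~ misses_pair X -> ~~ misses_pair Y by apply: contra (misses_pairS sXY).
have cXY := contains_pairS sXY.
have [t f] := (sub (el i0 true), sub (el i0 false)).
rewrite /switch_pred.
have [cY|cY] := boolP (contains_pair Y); last first.
  have cX : contains_pair X = false by apply: contraNF cY.
  rewrite cX /=.
  case: (boolP (el i0 true \in X)) => tX.
    rewrite t // => /orP[/f->//|/andP[mX pX]].
    case fY: (el i0 false \in Y) => //=.
    rewrite mXY //= -XY_eq ?tX ?t ?fY //.
    by apply: contraFF fY => /f.
  case/andP=> fX /andP[mX pX]; rewrite f // mXY //=.
  case tY: (el i0 true \in Y) => //.
  by rewrite -XY_eq ?fX ?f // tY; apply: negbTE.
case: (boolP (el i0 true \in X)) => tX.
  by rewrite t // => /orP[/f->//|/andP[/mXY->]]; rewrite orbT.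
by case/andP=> /f-> _ /=; case: ifP.
Qed.

(** Asking this of all sets spares the proofs below from checking that the sets they compare are
    transversals. *)
Definition alternating p :=
  forall i X, (forall b, el i b \notin X) ->
    p (el i true |: X) = ~~ p (el i false |: X).

Lemma alternating_neg p i b X : alternating p ->
  (forall c, el i c \notin X) -> p (el i b |: X) = ~~ p (el i (~~ b) |: X).
Proof. by move=> p_alt iX; case: b => /=; rewrite p_alt ?negbK. Qed.

Lemma idx_neq u : u != el i0 true -> u != el i0 false -> idx u != i0.
Proof.
move: u; apply: elP => i b; rewrite !el_eq idx_el.
by case: (i == i0) => //=; case: b.
Qed.

Lemma misses_pairU0 b X : misses_pair (el i0 b |: X) = misses_pair X.
Proof.
apply: eq_existsb => i; have [//|ni] := eqVneq i i0.
by rewrite !inE !el_eq (negbTE ni).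
Qed.

Lemma contains_pairU0 b X : contains_pair (el i0 b |: X) = contains_pair X.
Proof.
apply: eq_existsb => i; have [//|ni] := eqVneq i i0.
by rewrite !inE !el_eq (negbTE ni).
Qed.

Lemma switch_pred_true p X : el i0 true \in X -> el i0 false \notin X ->
  switch_pred p X = ~~ misses_pair X && (contains_pair X || p X).
Proof. by rewrite /switch_pred => -> /negbTE->. Qed.

Lemma switch_pred_false p X : el i0 true \notin X -> el i0 false \in X ->
  switch_pred p X = contains_pair X || ~~ misses_pair X && p X.
Proof. by rewrite /switch_pred => /negbTE-> ->. Qed.

(** * Alternating predicates leave no majority restriction *)

Section NoMajority.
Variables (p : {set V} -> bool) (v : 'I_3 -> V) (J : {set V}).
Hypotheses (p_alt : alternating p) (v_inj : injective v)
  (vJ : forall i, v i \notin J).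

(** Serves the case [el i0 true \in J]. If [J] misses a pair, two of the points must form it; adding
    either one to [J] then leaves no pair missed, so [p] is false on both sets, against alternation.
    If [J] misses no pair, it holds the partner of [v ord0], and [v ord0 |: J] contains a pair. *)
Lemma no_majority_true :
  (forall i, idx (v i) != i0) ->
  (forall i, misses_pair (v i |: J)
             || ~~ contains_pair (v i |: J) && ~~ p (v i |: J)) ->
  ~ (forall i j, i != j -> ~~ misses_pair (v i |: (v j |: J))).
Proof.
move=> vi0 h1 h2.
case: (boolP (misses_pair J)) => [/misses_pairP[i ni iJ]|mJ].
  have [k [l [vk vl]]] : exists k l, v k = el i true /\ v l = el i false.
    apply: majority_hits_pair => // k l /h2; apply: contraR.
    rewrite negb_or !inE !negb_or => /andP[/andP[kt kf] /andP[lt lf]].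
    apply/misses_pairP; exists i => // b; rewrite !inE !negb_or iJ andbT.
    by case: b; rewrite ![el _ _ == _]eq_sym ?kt ?kf ?lt ?lf.
  have kl : k != l by apply: contraTneq isT => e; move/eqP: vl; rewrite -e vk el_eq andbF.
  have mk a : ~~ misses_pair (el i a |: J).
    apply/misses_pairP => -[j nj jS].
    have nji : j != i by apply: contraTneq (jS a) => ->; rewrite setU11.
    have /misses_pairP[] := h2 _ _ kl; exists j => // b.
    by have := jS b; rewrite vk vl !inE !el_eq (negbTE nji).
  have := h1 k; have := h1 l; rewrite vk vl !(negbTE (mk _)) /=.
  move=> /andP[_ pl] /andP[_ pk]; have := p_alt iJ.
  by rewrite (negbTE pl) (negbTE pk).
have := h1 ord0; case/orP=> [|/andP[/negP[]]].
  by move/(misses_pairS (subsetUr _ _)); apply/negP.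
apply: (@contains_pairI _ (side (v ord0)) _ (vi0 ord0)).
  by rewrite elK setU11.
rewrite setU1r //; apply: contraR mJ; apply: misses_pairI => //.
by rewrite elK.
Qed.

(** Serves the case [el i0 false \in J]. Two of the three two-point extensions of [J] contain no
    pair, so [p] holds on both; they turn out to differ by a swap inside one pair, against
    alternation. *)
Lemma no_majority_false :
  (forall i, idx (v i) != i0) ->
  (forall i, ~~ contains_pair (v i |: J)) ->
  ~ (forall i j, i != j -> contains_pair (v i |: (v j |: J))
       || ~~ misses_pair (v i |: (v j |: J)) && p (v i |: (v j |: J))).
Proof.
move=> vi0 h1 h2.
(* Neither point alone completes a pair with [J], so a pair completed by both consists of these two
   points. *)
have full i j : contains_pair (v i |: (v j |: J)) ->
    v j = el (idx (v i)) (~~ side (v i)).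
  case/contains_pairP=> k nk kS.
  have out l : exists b, el k b \notin v l |: J.
    apply/existsP; apply: contraR (h1 l); rewrite negb_exists => /forallP kl.
    by apply/contains_pairP; exists k => // b; have := kl b; rewrite negbK.
  have [b bi] := out i; have [c cj] := out j.
  have vjE : v j = el k b.
    have := kS b; move: bi; rewrite !inE negb_or => /andP[/negbTE-> /negbTE->].
    by rewrite orbF => /eqP.
  have viE : v i = el k c.
    have := kS c; move: cj; rewrite !inE negb_or => /andP[/negbTE-> /negbTE->].
    by rewrite !orbF => /eqP.
  rewrite vjE viE idx_el side_el; congr el.
  have : b != c by apply: contraNneq cj => <-; rewrite vjE setU11.
  by case: b c {bi cj vjE viE} => -[].
have uniq_full i j k : j != k -> contains_pair (v i |: (v j |: J)) ->
    ~~ contains_pair (v i |: (v k |: J)).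
  move=> njk /full vjE; apply: contra njk => /full.
  by rewrite -vjE => /v_inj->.
(* A point has one partner, so at most one of the three two-point extensions contains a pair; [i] is
   the index shared by two others. *)
have [i [j [k [[ij ik jk] cij cik]]]] : exists i j k, [/\ [/\ i != j, i != k & j != k],
    ~~ contains_pair (v i |: (v j |: J)) & ~~ contains_pair (v i |: (v k |: J))].
  pose o1 : 'I_3 := Ordinal (isT : 1 < 3).
  have [c01|c01] := boolP (contains_pair (v ord0 |: (v o1 |: J))).
    exists ord_max, ord0, o1; split; rewrite // setUCA.
      exact: uniq_full c01.
    by apply: (@uniq_full _ ord0) => //; rewrite setUCA.
  have [c02|c02] := boolP (contains_pair (v ord0 |: (v ord_max |: J))).
    exists o1, ord0, ord_max; split; rewrite // setUCA //.
    by apply: (@uniq_full _ ord0) => //; rewrite setUCA.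
  by exists ord0, o1, ord_max.
have := h2 _ _ ij; have := h2 _ _ ik; rewrite (negbTE cij) (negbTE cik) /=.
move=> /andP[mik pik] /andP[mij pij].
have nvk l : l != k -> v k != v l by rewrite eq_sym (inj_eq v_inj).
(* The partner of [v k] lies in [v i |: (v j |: J)], which misses no pair, but not in [v i |: J];
   hence it is [v j]. *)
have wS : el (idx (v k)) (~~ side (v k)) \in v i |: (v j |: J).
  apply: contraR mij; apply: misses_pairI => //.
  by rewrite elK !inE !negb_or !nvk /= ?vJ.
have wX : el (idx (v k)) (~~ side (v k)) \notin v i |: J.
  apply: contra cik => wX; apply: (@contains_pairI _ (side (v k)) _ (vi0 k)).
    by rewrite elK !inE eqxx orbT.
  by rewrite setUCA setU1r.
have vjE : v j = el (idx (v k)) (~~ side (v k)).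
  move: wX wS; rewrite !inE negb_or => /andP[/negbTE-> /negbTE->].
  by rewrite orbF => /eqP.
have kX c : el (idx (v k)) c \notin v i |: J.
  have [->|] := eqVneq c (~~ side (v k)); first exact: wX.
  move=> nc; have -> : c = side (v k) by case: c (side _) nc => -[].
  by rewrite elK !inE negb_or nvk /= ?vJ.
have := alternating_neg (side (v k)) p_alt kX.
by rewrite elK -vjE setUCA pik setUCA pij.
Qed.

End NoMajority.

Lemma switch_pred_no_majority p :
  alternating p -> ~ majority_restriction (switch_pred p).
Proof.
move=> p_alt [v [J [g1 g2]]].
have v_inj := majority_inj g1 g2; have vJ := majority_notin g1 g2.
have [xJ|xJ] := boolP (el i0 true \in J).
  have yJ : el i0 false \notin J.
    by apply: contra (g1 ord0) => yJ; rewrite /switch_pred !inE xJ yJ !orbT.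
  have vy i : v i != el i0 false.
    by apply: contraNneq (g1 i) => ->; rewrite /switch_pred !inE xJ eqxx !orbT.
  have vx i : v i != el i0 true by apply: contraNneq (vJ i) => ->.
  apply: (no_majority_true p_alt v_inj vJ) => [i|i|i j ij].
  - exact: idx_neq.
  - have := g1 i; rewrite switch_pred_true ?inE ?xJ ?orbT //; last first.
      by rewrite negb_or eq_sym vy.
    by rewrite negb_and negbK negb_or.
  - have := g2 i j ij; rewrite switch_pred_true ?inE ?xJ ?orbT //; last first.
      by rewrite !negb_or ![el _ _ == _]eq_sym !vy.
    by case/andP.
have [yJ|yJ] := boolP (el i0 false \in J).
  have vx i : v i != el i0 true.
    by apply: contraNneq (g1 i) => ->; rewrite /switch_pred !inE yJ eqxx !orbT.
  have vy i : v i != el i0 false by apply: contraNneq (vJ i) => ->.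
  apply: (no_majority_false p_alt v_inj vJ) => [i|i|i j ij].
  - exact: idx_neq.
  - have := g1 i; rewrite switch_pred_false ?inE ?yJ ?orbT //; last first.
      by rewrite negb_or eq_sym vx.
    by rewrite negb_or => /andP[].
  - have := g2 i j ij; rewrite switch_pred_false ?inE ?yJ ?orbT //.
    by rewrite !negb_or ![el _ _ == _]eq_sym !vx.
(* Now [J] avoids the distinguished pair, and the predicate is false on sets avoiding it, so any two
   points must include one of its elements. *)
have [k [l [vk vl]]] : exists k l, v k = el i0 true /\ v l = el i0 false.
  apply: majority_hits_pair => // i j /g2; apply: contraLR.
  rewrite negb_or !inE !negb_or => /andP[/andP[it jf] /andP[jt jff]].
  rewrite /switch_pred !inE ![el _ _ == _]eq_sym.
  by rewrite (negbTE it) (negbTE jf) (negbTE jt) (negbTE jff) (negbTE xJ) (negbTE yJ).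
have [m /andP[mk ml]] := ord3_third k l.
have cx b : el i0 b \notin v m |: J.
  rewrite !inE negb_or; case: b; rewrite ?xJ ?yJ andbT -?vk -?vl;
  by rewrite (inj_eq v_inj) eq_sym.
have J0 b : el i0 b \notin J by apply: contra (cx b); apply: setU1r.
have a1 := g1 k; have a2 := g1 l.
have b1 : switch_pred p (v k |: (v m |: J)) by rewrite g2 // eq_sym.
have b2 : switch_pred p (v l |: (v m |: J)) by rewrite g2 // eq_sym.
have N X : (forall b, el i0 b \notin X) -> el i0 false \notin el i0 true |: X.
  by move=> X0; rewrite !inE negb_or X0 el_eq eqxx.
have N' X : (forall b, el i0 b \notin X) -> el i0 true \notin el i0 false |: X.
  by move=> X0; rewrite !inE negb_or X0 el_eq eqxx.
move: a1 a2 b1 b2; rewrite vk vl.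
rewrite ?(switch_pred_true _ (setU11 _ _)) ?N // ?switch_pred_false ?N' ?setU11 //.
rewrite !misses_pairU0 !contains_pairU0.
(* If [J] misses no pair, the one-point values make [p] false on both [el i0 b |: J]. Otherwise the
   two-point values force [v m] into the missed pair, no pair is contained, and [p] is true on both
   [el i0 b |: (v m |: J)]. Either way alternation fails. *)
case: (boolP (misses_pair J)) => /= [/misses_pairP[i ni iJ] _|mJ]; last first.
  rewrite !negb_or => /andP[_ px] /andP[_ py] _ _.
  by have := p_alt _ _ J0; rewrite (negbTE px) (negbTE py).
rewrite orbF => cJ /andP[mcJ cpx].
have [b vm] : exists b, v m = el i b.
  apply/exists_eqP; apply: contraR mcJ; rewrite negb_exists => /forallP nb.
  by apply/misses_pairP; exists i => // b; rewrite !inE negb_or iJ eq_sym nb.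
have ccJ : contains_pair (v m |: J) = false.
  apply: contraNF cJ => /contains_pairP[j nj jS]; apply/contains_pairP.
  exists j => // c; have := jS c; rewrite !inE vm el_eq.
  suff /negbTE-> : j != i by [].
  apply/eqP => ji; have := jS (~~ b).
  by rewrite ji !inE vm el_eq (negbTE (iJ _)); case: (b) => /=; rewrite andbF.
move: cpx; rewrite ccJ mcJ /= => px py.
by have := p_alt _ _ cx; rewrite px py.
Qed.

(** * Transversals, and the effect of flipping [p] at one of them *)

Definition transversal (t : {ffun I -> bool}) := [set u | side u == t (idx u)].

Lemma el_transversal t i b : (el i b \in transversal t) = (b == t i).
Proof. by rewrite inE side_el idx_el. Qed.

Lemma transversal_inj : injective transversal.
Proof.
move=> t t' tt'; apply/ffunP => i.
have := el_transversal t i (t i); rewrite tt' el_transversal eqxx.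
by move/eqP.
Qed.

Lemma switch_pred_transversal p t : switch_pred p (transversal t) = p (transversal t).
Proof.
have m : misses_pair (transversal t) = false.
  apply/misses_pairP => -[i _ /(_ (t i))].
  by rewrite el_transversal eqxx.
have c : contains_pair (transversal t) = false.
  apply/contains_pairP => -[i _ /(_ (~~ t i))].
  by rewrite el_transversal; case: (t i).
by rewrite /switch_pred m c !el_transversal /=; case: (t i0).
Qed.

(** The transversals add [el i0 true] and [el i0 false] to a common part [J0]; these are two of the
    points, and the third comes from pair [i1]. If [p] is true on both, it is the element of [J0] in
    that pair, removed from [J0]; if false, it is the partner of that element. *)
Lemma switch_pred_majority p i1 (t t' : {ffun I -> bool}) :
  i1 != i0 -> (forall i, i != i0 -> t i = t' i) -> t i0 -> ~~ t' i0 ->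
  p (transversal t) = p (transversal t') ->
  majority_restriction (switch_pred p).
Proof.
move=> ni1 tt' t0 t'0 ptt'.
pose J0 := [set u | (idx u != i0) && (side u == t (idx u))].
have tE : transversal t = el i0 true |: J0.
  apply/setP; apply: elP => i b; rewrite !inE el_eq side_el idx_el.
  by have [->|//] := eqVneq i i0; rewrite t0 /= orbF.
have t'E : transversal t' = el i0 false |: J0.
  apply/setP; apply: elP => i b; rewrite !inE el_eq side_el idx_el.
  have [->|ni] := eqVneq i i0; first by rewrite (negbTE t'0) /= orbF.
  by rewrite tt'.
have J0N b : el i0 b \notin J0 by rewrite !inE idx_el eqxx.
case: (boolP (p (transversal t))) => pt.
  pose J1 := J0 :\ el i1 (t i1).
  have J1E : J0 = el i1 (t i1) |: J1.
    by rewrite setD1K // inE idx_el side_el ni1 eqxx.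
  have J1N b : el i0 b \notin J1 by rewrite !inE idx_el eqxx /= andbF.
  have mJ1 : misses_pair J1.
    apply: (misses_pairI (b := t i1) ni1); first by rewrite setD11.
    by rewrite !inE idx_el side_el; case: (t i1); rewrite !andbF.
  have cJ1 : contains_pair J1 = false.
    apply/contains_pairP => -[i _ /(_ (~~ t i))].
    by rewrite !inE idx_el side_el; case: (t i); rewrite !andbF.
  apply: (@majority_restrictionI _ _ (el i0 true) (el i0 false) (el i1 (t i1)) J1).
  - by rewrite /switch_pred misses_pairU0 mJ1 setU11 /= orbF in_setU1 el_eq andbF J1N.
  - rewrite switch_pred_false ?setU11 ?misses_pairU0 ?contains_pairU0 ?mJ1 ?cJ1 //.
    by rewrite in_setU1 el_eq andbF J1N.
  - by rewrite -J1E /switch_pred !(negbTE (J0N _)).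
  - by rewrite /switch_pred !inE !eqxx !orbT.
  - by rewrite -J1E -tE switch_pred_transversal.
  - by rewrite -J1E -t'E switch_pred_transversal -ptt'.
pose c := el i1 (~~ t i1).
have ccJ : contains_pair (c |: J0).
  apply: (contains_pairI (b := t i1) ni1); last by rewrite setU11.
  by rewrite !inE idx_el side_el eqxx ni1 orbT.
have mJ : misses_pair (c |: J0) = false.
  apply/misses_pairP => -[i ni /(_ (t i))].
  by rewrite !inE idx_el side_el eqxx ni orbT.
have cN b : el i0 b \notin c |: J0.
  by rewrite !inE negb_or el_eq eq_sym (negbTE ni1) idx_el eqxx.
apply: (@majority_restrictionI _ _ (el i0 true) (el i0 false) c J0).
- by rewrite -tE switch_pred_transversal.
- by rewrite -t'E switch_pred_transversal -ptt'.
- by rewrite /switch_pred !(negbTE (cN _)).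
- by rewrite /switch_pred !inE !eqxx !orbT.
- by rewrite /switch_pred misses_pairU0 contains_pairU0 ccJ mJ setU11 orbT.
- by rewrite /switch_pred contains_pairU0 ccJ !inE eqxx /=; case: ifP.
Qed.

(** Only one side is counted, since a swap inside a pair preserves the cardinality of the whole
    set. *)
Definition parity X := odd #|X :&: [set u | side u]|.

Lemma parity_alternating : alternating parity.
Proof.
move=> i X iX; rewrite /parity !setIUl.
have -> : [set el i true] :&: [set u | side u] = [set el i true].
  by apply/setIidPl; rewrite sub1set inE side_el.
have -> : [set el i false] :&: [set u | side u] = set0.
  apply/setP => u; rewrite !inE; apply/negP => /andP[/eqP->].
  by rewrite side_el.
by rewrite set0U cardsU1 inE (negbTE (iX _)).
Qed.

(** Alternation gives [t] and its swap at [i0] opposite values of [p]; flipping at [t] alone makes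
    them equal. *)
Lemma flipped_majority p i1 t : i1 != i0 -> alternating p ->
  majority_restriction (switch_pred (fun X => (X == transversal t) (+) p X)).
Proof.
move=> ni1 p_alt.
pose s b := [ffun i => if i == i0 then b else t i] : {ffun I -> bool}.
have s0 b : s b i0 = b by rewrite ffunE eqxx.
have sN b i : i != i0 -> s b i = t i by rewrite ffunE => /negbTE->.
have sE b : transversal (s b) = el i0 b |: [set u | (idx u != i0) && (side u == t (idx u))].
  apply/setP; apply: elP => i c; rewrite !inE el_eq side_el idx_el.
  by have [->|ni] := eqVneq i i0; rewrite ?s0 ?orbF // sN.
have ts : t = s (t i0).
  by apply/ffunP => i; rewrite ffunE; case: eqP => [->|].
apply: (@switch_pred_majority _ _ (s true) (s false) ni1); rewrite ?s0 //.
  by move=> i ni; rewrite !sN.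
have eqs b : (transversal (s b) == transversal t) = (b == t i0).
  apply/eqP/eqP => [/transversal_inj<-|->]; by rewrite ?s0 // -ts.
rewrite !eqs !sE (p_alt i0).
  by case: (t i0); case: (p _).
by move=> b; rewrite !inE idx_el eqxx.
Qed.

(** * Counting the queries *)

Lemma card_transversals : #|[set transversal t | t : {ffun I -> bool}]| = 2 ^ #|I|.
Proof. by rewrite card_imset ?card_ffun ?card_bool //; apply: transversal_inj. Qed.

(** A run on the parity clutter with fewer calls leaves some transversal unqueried; flipping there
    creates a minor without changing any answer received. *)
Lemma calls_lower_bound i1 (D : algorithm V) :
  i1 != i0 -> decides_Delta3_minor D ->
  2 ^ #|I| <= calls D (filter_oracle (clutter_of (switch_pred parity))).
Proof.
move=> ni1 hD.
have orc p := filter_oracle_clutter_of (@switch_pred_mono p).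
have [qs <- qsP] := output_determined D (filter_oracle (clutter_of (switch_pred parity))).
have noD : output D (filter_oracle (clutter_of (switch_pred parity))) = false.
  apply/negP => /hD /majority_of_Delta3 [v [J [g1 g2]]].
  apply: (switch_pred_no_majority parity_alternating); exists v, J.
  by split=> [i|i j /g2]; rewrite -orc.
rewrite -card_transversals leqNgt; apply/negP => small.
have /subsetPn[_ /imsetP[t _ ->] tqs] :
    ~~ ([set transversal t | t : {ffun I -> bool}] \subset [set X in qs]).
  apply: contraTN small => /subset_leq_card; rewrite -leqNgt => le_qs.
  by apply: leq_trans le_qs _; rewrite cardsE card_size.
pose q X := (X == transversal t) (+) parity X.
have /qsP : {in qs, filter_oracle (clutter_of (switch_pred parity))
                    =1 filter_oracle (clutter_of (switch_pred q))}.
  move=> X Xqs; rewrite !orc /switch_pred /q.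
  suff /negbTE-> : X != transversal t by [].
  by apply: contraNneq tqs => <-; rewrite inE.
rewrite noD; suff /hD -> : has_minor (clutter_of (switch_pred q)) Delta3 by [].
apply: Delta3_of_majority.
have [v [J [g1 g2]]] := flipped_majority t ni1 parity_alternating.
by exists v, J; split=> [i|i j /g2]; rewrite orc.
Qed.

End Pairs.

Theorem theorem2 (n : nat) (hn : 2 <= n) (V : finType) (hV : #|V| = 2 * n)
    (D : algorithm V) (hD : decides_Delta3_minor D) :
  exists C : clutter [set: V], 2 ^ n <= calls D (filter_oracle C).
Proof.
have cV : #|V| = #|{: 'I_n * bool}| by rewrite card_prod card_ord card_bool mulnC.
pose f u : 'I_n * bool := enum_val (cast_ord cV (enum_rank u)).
pose g w : V := enum_val (cast_ord (esym cV) (enum_rank w)).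
have fK : cancel f g by move=> u; rewrite /f /g enum_valK cast_ordK enum_rankK.
have gK : cancel g f by move=> w; rewrite /f /g enum_valK cast_ordKV enum_rankK.
(* Pair 0 is the distinguished one, and [2 <= n] supplies pair 1 as the other pair. *)
have i01 : Ordinal hn != Ordinal (ltnW hn) by [].
have := calls_lower_bound (V := V) (el := fun i b => g (i, b))
  (idx := fun u => (f u).1) (side := fun u => (f u).2) _ _ _ i01 hD.
rewrite card_ord => bound; eexists; apply: bound => [u|i b|i b].
- by rewrite -surjective_pairing fK.
- by rewrite gK.
- by rewrite gK.
Qed.
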